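(* Let $\mathcal{G}$ be a real Hilbert space, let $\varphi\in\Gamma_0(\mathcal{G})$, let $\widetilde{\varphi}\colon\mathbb{R}\oplus\mathcal{G}\to\left]-\infty,+\infty\right]$ be the perspective of $\varphi$, let $\gamma\in\left]0,+\infty\right[$, let $\eta\in\mathbb{R}$, and let $y\in\mathcal{G}$. Then the following hold: (i) Suppose that $\eta+\gamma\varphi^*(y/\gamma)\leq 0$. Then $\operatorname{prox}_{\gamma\widetilde{\varphi}}(\eta,y)=(0,0)$. (ii) Suppose that $\operatorname{dom}\varphi^*$ is open and that $\eta+\gamma\varphi^*(y/\gamma)>0$. Then $$\operatorname{prox}_{\gamma\widetilde{\varphi}}(\eta,y)=\big(\eta+\gamma\varphi^*(p),\,y-\gamma p\big),$$ where $p$ is the unique solution to the inclusion $$y\in\gamma p+\big(\eta+\gamma\varphi^*(p)\big)\,\partial\varphi^*(p).$$ If $\varphi^*$ is differentiable at $p$, then $p$ is characterized by $y=\gamma p+(\eta+\gamma\varphi^*(p))\nabla\varphi^*(p)$.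
   Context: For a real Hilbert space $\mathcal{K}$, $\Gamma_0(\mathcal{K})$ denotes the class of proper lower semicontinuous convex functions $f\colon\mathcal{K}\to\left]-\infty,+\infty\right]$, and $\operatorname{dom}f=\{x\in\mathcal{K}\mid f(x)<+\infty\}$. The conjugate of $f\in\Gamma_0(\mathcal{K})$ is $f^*(u)=\sup_{x\in\mathcal{K}}(\langle x\mid u\rangle-f(x))$, its subdifferential is $\partial f(x)=\{u\in\mathcal{K}\mid(\forall w\in\operatorname{dom}f)\ \langle w-x\mid u\rangle+f(x)\leq f(w)\}$, and its proximity operator is $\operatorname{prox}_f x=\operatorname{argmin}_{w\in\mathcal{K}}\big(f(w)+\tfrac12\|x-w\|^2\big)$ (a unique minimizer). If $f$ is Gâteaux differentiable at $x\in\operatorname{dom}f$, its gradient there is denoted by $\nabla f(x)$, and $\partial f(x)=\{\nabla f(x)\}$. The recession function of $f$ is $(\operatorname{rec}f)(y)=\lim_{\alpha\to+\infty}f(z+\alpha y)/\alpha$, where $z$ is any point in $\operatorname{dom}f$. $\mathbb{R}\oplus\mathcal{G}$ is the Hilbert direct sum. The perspective of $\varphi\in\Gamma_0(\mathcal{G})$ is the function $$\widetilde{\varphi}\colon\mathbb{R}\times\mathcal{G}\to\left]-\infty,+\infty\right]\colon(\eta,y)\mapsto\begin{cases}\eta\varphi(y/\eta),&\text{if }\eta>0;\\(\operatorname{rec}\varphi)(y),&\text{if }\eta=0;\\+\infty,&\text{if }\eta<0,\end{cases}$$ which belongs to $\Gamma_0(\mathbb{R}\oplus\mathcal{G})$.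
   Formalization: The uniqueness of p and its gradient characterization are asserted only among points q with η+γφ*(q) ≥ 0, and p has η+γφ*(p) > 0; literal uniqueness fails, e.g. for G=ℝ, φ(x)=x²/20, γ=1, η=−1, y=0.45. *)

(* Defs.v *)
From HB Require Import structures.
From mathcomp Require Import all_boot all_order all_algebra.
From mathcomp Require Import all_classical all_reals all_analysis.
From mathcomp Require Import ring lra.

Set Implicit Arguments.
Unset Strict Implicit.
Unset Printing Implicit Defensive.
Import Order.TTheory GRing.Theory Num.Theory.
Import numFieldNormedType.Exports.
Local Open Scope classical_set_scope.
Local Open Scope ring_scope.

HB.mixin Record CompleteNormedModule_isHilbert (R : realType) H
    & CompleteNormedModule R H := {
  hdot : H -> H -> R ;
  hdotC : forall x y : H, hdot x y = hdot y x ;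
  hdot_linearl : forall z : H, scalar (hdot ^~ z) ;
  sqr_norm_hdot : forall x : H, `|x| ^+ 2 = hdot x x
}.

#[short(type="hilbertType")]
HB.structure Definition Hilbert (R : realType) :=
  {H of CompleteNormedModule_isHilbert R H & CompleteNormedModule R H}.

Notation "''[' u , v ]" := (hdot u v) : ring_scope.

Section RegularHilbert.
Context {R : realType}.

Let rdot (x y : R^o) : R := x * y.

Let rdotC (x y : R^o) : rdot x y = rdot y x.
Proof. exact: mulrC. Qed.

Let rdot_linearl (z : R^o) : scalar (rdot ^~ z).
Proof. by move=> a u v; rewrite /rdot mulrDl -mulrA. Qed.

Let sqr_norm_rdot (x : R^o) : `|x| ^+ 2 = rdot x x.
Proof. by rewrite real_normK ?num_real// expr2. Qed.

HB.instance Definition _ := CompleteNormedModule_isHilbert.Build R R^o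
  rdotC rdot_linearl sqr_norm_rdot.

End RegularHilbert.

(* The type U * V already carries the max norm, hence the alias. *)
Definition hsum (R : realType) (U V : hilbertType R) : Type := (U * V)%type.

Notation "U ⊕ V" := (hsum U V) (at level 50, left associativity) : type_scope.

Section HilbertDirectSum.
Context {R : realType} {U V : hilbertType R}.

HB.instance Definition _ := GRing.Lmodule.copy (U ⊕ V) (U * V)%type.

Definition hsum_norm (x : U ⊕ V) : R :=
  Num.sqrt (`|x.1| ^+ 2 + `|x.2| ^+ 2).

Let sqn_ge0 (x : U ⊕ V) : 0 <= `|x.1| ^+ 2 + `|x.2| ^+ 2.
Proof. by rewrite addr_ge0// sqr_ge0. Qed.

Let hsum_normD (x y : U ⊕ V) : hsum_norm (x + y) <= hsum_norm x + hsum_norm y.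
Proof.
have le0 := addr_ge0 (sqrtr_ge0 (`|x.1| ^+ 2 + `|x.2| ^+ 2))
  (sqrtr_ge0 (`|y.1| ^+ 2 + `|y.2| ^+ 2)).
rewrite /hsum_norm -(ger0_norm le0) -sqrtr_sqr ler_wsqrtr//.
rewrite sqrrD !sqr_sqrtr//=.
have := ler_normD x.1 y.1; have := ler_normD x.2 y.2.
have := normr_ge0 (x.1 + y.1); have := normr_ge0 (x.2 + y.2).
have := normr_ge0 x.1; have := normr_ge0 x.2.
have := normr_ge0 y.1; have := normr_ge0 y.2.
rewrite -sqrtrM//.
move: `|x.1| `|x.2| `|y.1| `|y.2| `|x.1 + y.1| `|x.2 + y.2|.
move=> a b c d e f d0 c0 b0 a0 f0 e0 fbd eac.
have CS : a * c + b * d <=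
    Num.sqrt ((a ^+ 2 + b ^+ 2) * (c ^+ 2 + d ^+ 2)).
  have h : 0 <= a * c + b * d by rewrite addr_ge0// mulr_ge0.
  rewrite -[leLHS](ger0_norm h) -sqrtr_sqr ler_wsqrtr//.
  rewrite -subr_ge0 (_ : _ - _ = (a * d - b * c) ^+ 2) ?sqr_ge0//.
  by ring.
have e2 : e ^+ 2 <= (a + c) ^+ 2 by rewrite lerXn2r ?nnegrE ?addr_ge0.
have f2 : f ^+ 2 <= (b + d) ^+ 2 by rewrite lerXn2r ?nnegrE ?addr_ge0.
by lra.
Qed.

Let hsum_normZ (l : R) (x : U ⊕ V) : hsum_norm (l *: x) = `|l| * hsum_norm x.
Proof.
by rewrite /hsum_norm /= !normrZ !exprMn -mulrDr sqrtrM ?sqr_ge0// sqrtr_sqr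
  normr_id.
Qed.

Let hsum_norm0_eq0 (x : U ⊕ V) : hsum_norm x = 0 -> x = 0.
Proof.
move=> /eqP; rewrite sqrtr_eq0 => h.
have /eqP : `|x.1| ^+ 2 + `|x.2| ^+ 2 = 0.
  by apply/eqP; rewrite eq_le h sqn_ge0.
rewrite paddr_eq0 ?sqr_ge0// !expf_eq0/= !normr_eq0 => /andP[/eqP x1 /eqP x2].
by case: x x1 x2 h => /= ? ? -> ->.
Qed.

HB.instance Definition _ := Lmodule_isNormed.Build R (U ⊕ V)
  hsum_normD hsum_normZ hsum_norm0_eq0.

Lemma hsum_normE (x : U ⊕ V) : `|x| = hsum_norm x. Proof. by []. Qed.

Let le_hsum_norm1 (x : U ⊕ V) : `|x.1| <= hsum_norm x.
Proof. by rewrite -[leLHS]normr_id -sqrtr_sqr ler_wsqrtr// lerDl sqr_ge0. Qed.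

Let le_hsum_norm2 (x : U ⊕ V) : `|x.2| <= hsum_norm x.
Proof. by rewrite -[leLHS]normr_id -sqrtr_sqr ler_wsqrtr// lerDr sqr_ge0. Qed.

Let hsum_norm_le (x : U ⊕ V) : hsum_norm x <= `|x.1| + `|x.2|.
Proof.
rewrite -[leRHS]ger0_norm ?addr_ge0// -sqrtr_sqr ler_wsqrtr//.
by rewrite sqrrD -addrA addrCA lerDr mulrn_wge0// mulr_ge0.
Qed.

Let hsum_complete (F : set_system (U ⊕ V)) :
  ProperFilter F -> cauchy F -> cvg F.
Proof.
move=> FF /cauchyP Fc.
have /cauchy_cvg/cvg_ex[a /cvgrPdist_lt Fa] :
    cauchy ((fun x : U ⊕ V => x.1) @ F).
  apply/cauchyP => e e0; have [x Fx] := Fc e e0; exists x.1.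
  suff : F [set y | ball x.1 e y.1] by [].
  apply: filterS Fx => y /=; rewrite -!ball_normE /=; apply: le_lt_trans.
  exact: le_hsum_norm1 (x - y).
have /cauchy_cvg/cvg_ex[b /cvgrPdist_lt Fb] :
    cauchy ((fun x : U ⊕ V => x.2) @ F).
  apply/cauchyP => e e0; have [x Fx] := Fc e e0; exists x.2.
  suff : F [set y | ball x.2 e y.2] by [].
  apply: filterS Fx => y /=; rewrite -!ball_normE /=; apply: le_lt_trans.
  exact: le_hsum_norm2 (x - y).
apply/cvg_ex; exists ((a, b) : U ⊕ V); apply/cvgrPdist_lt => e e0.
have e20 : 0 < e / 2 by rewrite divr_gt0.
near=> x; rewrite hsum_normE; apply: le_lt_trans (hsum_norm_le _) _.
rewrite [ltRHS]splitr ltrD//=.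
- by near: x; exact: Fa.
- by near: x; exact: Fb.
Unshelve. all: by end_near. Qed.

HB.instance Definition _ := Uniform_isComplete.Build (U ⊕ V) hsum_complete.

Definition hsum_dot (x y : U ⊕ V) : R := '[x.1, y.1] + '[x.2, y.2].

Let hsum_dotC (x y : U ⊕ V) : hsum_dot x y = hsum_dot y x.
Proof. by rewrite /hsum_dot hdotC [X in _ + X]hdotC. Qed.

Let hsum_dot_linearl (z : U ⊕ V) : scalar (hsum_dot ^~ z).
Proof.
by move=> a x y; rewrite /hsum_dot /= !hdot_linearl /= mulrDr addrACA.
Qed.

Let sqr_norm_hsum_dot (x : U ⊕ V) : `|x| ^+ 2 = hsum_dot x x.
Proof. by rewrite hsum_normE sqr_sqrtr// /hsum_dot !sqr_norm_hdot. Qed.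

HB.instance Definition _ := CompleteNormedModule_isHilbert.Build R (U ⊕ V)
  hsum_dotC hsum_dot_linearl sqr_norm_hsum_dot.

End HilbertDirectSum.

Local Open Scope ereal_scope.

Section ConvexAnalysis.
Context {R : realType} {H : hilbertType R}.
Implicit Types (f : H -> \bar R) (x y u w z : H).

Definition edom f : set H := [set x | f x < +oo].

Definition econvex f := forall x y (t : R), (0 < t < 1)%R ->
  f (t *: x + (1 - t) *: y)%R <= t%:E * f x + (1 - t)%:E * f y.

(* Γ_0(H); the codomain \bar R contains -oo, which has to be excluded. *)
Record Gamma0 f : Prop := {
  Gamma0_gtNy : forall x, -oo < f x ;
  Gamma0_dom : edom f !=set0 ;
  Gamma0_lsc : lower_semicontinuous f ;
  Gamma0_convex : econvex f
}.

Definition conjugate f u : \bar R :=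
  ereal_sup [set '[x, u]%:E - f x | x in [set: H]].

Definition subdiff f x : set H :=
  [set u | forall w, edom f w -> '[w - x, u]%:E + f x <= f w].

Definition argmin f : set H := [set w | forall z, f w <= f z].

(* Set-valued: "prox f x is the point p" reads [prox f x = [set p]], which
   includes existence and uniqueness of the minimizer. *)
Definition prox f x : set H :=
  argmin (fun w => f w + (2^-1 * `|x - w| ^+ 2)%:E).

(* [gradient_at f x g] : f is Gateaux differentiable at x, with gradient g.
   The difference quotient is taken in \bar R, so that its convergence forces
   f to be finite close to x on each line through x. *)
Definition gradient_at f x (g : H) := f x \is a fin_num /\
  forall v : H, (fun t : R => t^-1%:E * (f (x + t *: v)%R - f x)) @ 0%R^'
    --> '[v, g]%:E.

(* The limit does not depend on the base point z when f is in Gamma0. *)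
Definition recession f y : \bar R :=
  let z := xget 0%R (edom f) in
  lim ((fun a : R => a^-1%:E * f (z + a *: y)%R) @ +oo%R).

End ConvexAnalysis.

Definition perspective (R : realType) (G : hilbertType R)
    (phi : G -> \bar R) (x : R^o ⊕ G) : \bar R :=
  if (0 < x.1)%R then x.1%:E * phi (x.1^-1 *: x.2)%R
  else if x.1 == 0%R then recession phi x.2
  else +oo.

(* y \in gamma p + (eta + gamma f(p)) \partial f(p); for f in Gamma0 the
   subdifferential is empty at the points where f is infinite, hence [fine]
   only matters on finite values. *)
Definition prox_inclusion (R : realType) (G : hilbertType R)
    (f : G -> \bar R) (gamma eta : R) (y p : G) : Prop :=
  [set gamma *: p + fine (eta%:E + gamma%:E * f p) *: u
    | u in subdiff f p]%R y.

(* Main.v *)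
Require Import Defs.
From HB Require Import structures.
From mathcomp Require Import all_boot all_order all_algebra.
From mathcomp Require Import all_classical all_reals all_analysis.
From mathcomp Require Import ring lra.

Set Implicit Arguments.
Unset Strict Implicit.
Unset Printing Implicit Defensive.
Import Order.TTheory GRing.Theory Num.Theory.
Import numFieldNormedType.Exports.
Local Open Scope classical_set_scope.
Local Open Scope ring_scope.

(** Let f be the conjugate of phi. The pairs (m, u) for which m + <., u> is an
affine minorant of phi are exactly those with m + f u <= 0; they form a closed
convex set C in the direct sum, and the perspective of phi lies above the
support function of C: where the first variable is positive this is the minorant
property rescaled, and where it is zero it survives in the limit that defines
the recession function ([affine_minorant_perspective]).

A function F that dominates the linear form <., c> and agrees with it at p has
p as the only point of prox F at p + c, because adding half the squared distance
to p + c leaves a quadratic growth around p ([prox_support]). This yields both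
parts. In (i) the hypothesis says that (eta, y) / gamma lies in C, so c = (eta, y)
and p = 0 work, the perspective being 0 at the origin. In (ii), a solution q of the inclusion gives
u in the subdifferential of f at q with y - gamma q = tau u, where
tau = eta + gamma f(q) > 0; one takes c = gamma (- f q, q) and p = tau (1, u).
That the perspective equals <., (- f q, q)> at p is the equality
phi u = <u, q> - f q, which needs that phi is the supremum of its affine
minorants ([lt_affine_minorant], [subdiff_conjugate]).

Uniqueness of q thus follows from uniqueness of the proximal point, the
boundary value tau = 0 being excluded since it would force q = y / gamma.
For existence, (eta, y) / gamma is projected onto C
([prox_inclusion_exists]): the projection (m, p) satisfies a variational
inequality which, once the first component of the residual is known to be
positive, reads m = - f p together with the inclusion at p. This component is
nonnegative because m can be lowered freely inside C, and if it vanished, the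
other component would be normal at p to the domain of f, hence zero as this
domain is open, so that (eta, y) / gamma would belong to C.

When f is differentiable at q, its subdifferential there is the singleton of the
gradient ([subdiff_gradient]), which gives the last characterization. *)

(** * Inner products *)

Section InnerProduct.
Context {R : realType} {H : hilbertType R}.
Implicit Types (x y z u : H) (a : R).

Lemma hdotDl x y z : '[x + y, z] = '[x, z] + '[y, z].
Proof. by have := hdot_linearl z 1 x y; rewrite /= scale1r mul1r. Qed.

Lemma hdot0l z : '[0, z] = 0 :> R.
Proof. by apply: (addrI '[0, z]); rewrite -hdotDl !addr0. Qed.

Lemma hdotZl a x z : '[a *: x, z] = a * '[x, z].
Proof. by have := hdot_linearl z a x 0; rewrite /= hdot0l !addr0. Qed.

Lemma hdotNl x z : '[- x, z] = - '[x, z].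
Proof. by rewrite -scaleN1r hdotZl mulN1r. Qed.

Lemma hdotDr z x y : '[z, x + y] = '[z, x] + '[z, y].
Proof. by rewrite !(hdotC z) hdotDl. Qed.

Lemma hdotZr a z x : '[z, a *: x] = a * '[z, x].
Proof. by rewrite !(hdotC z) hdotZl. Qed.

Lemma hdotNr z x : '[z, - x] = - '[z, x].
Proof. by rewrite !(hdotC z) hdotNl. Qed.

Lemma hdot0r z : '[z, 0] = 0 :> R.
Proof. by rewrite hdotC hdot0l. Qed.

Definition hdotE := (hdotDl, hdotDr, hdotNl, hdotNr, hdotZl, hdotZr).

Lemma hdot_ge0 x : 0 <= '[x, x] :> R.
Proof. by rewrite -sqr_norm_hdot sqr_ge0. Qed.

Lemma hdot_eq0 x : ('[x, x] == 0 :> R) = (x == 0).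
Proof. by rewrite -sqr_norm_hdot sqrf_eq0 normr_eq0. Qed.

Lemma hdot_gt0 x : x != 0 -> 0 < '[x, x] :> R.
Proof. by move=> x0; rewrite lt_neqAle eq_sym hdot_eq0 x0 hdot_ge0. Qed.

(** The vector <y, y> x - <x, y> y, a multiple of the part of x orthogonal to y,
has a nonnegative square norm. *)
Lemma Cauchy_Schwarz x y : `|'[x, y]| <= `|x| * `|y| :> R.
Proof.
have [->|y0] := eqVneq y 0; first by rewrite hdot0r !normr0 mulr0.
have y2 := hdot_gt0 y0.
rewrite -[leRHS]ger0_norm ?mulr_ge0// -ler_sqr ?nnegrE// -!normrX.
rewrite !ger0_norm ?sqr_ge0// exprMn !sqr_norm_hdot.
rewrite -(ler_pM2l y2) -subr_ge0.
have := hdot_ge0 ('[y, y] *: x - '[x, y] *: y).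
rewrite !hdotE (hdotC y x) => h.
by rewrite (le_trans h)// le_eqVlt; apply/orP; left; apply/eqP; ring.
Qed.

Lemma closed_halfspace x a : closed [set u | '[x, u] <= a].
Proof.
apply: (@closed_comp _ _ (fun u : H => '[x, u]) [set t | t <= a]).
  move=> u _; apply/cvgrPdist_lt => e e0.
  apply/nbhs_ballP; exists (e / (`|x| + 1)) => /= [|v].
    by rewrite divr_gt0// ltr_wpDl.
  rewrite -ball_normE /= ltr_pdivlMr ?ltr_wpDl// => uv.
  rewrite -hdotNr -hdotDr (le_lt_trans (Cauchy_Schwarz _ _))//.
  rewrite (le_lt_trans _ uv)// mulrC ler_wpM2l//.
  by rewrite lerDl.
exact: closed_le.
Qed.

End InnerProduct.

Section DirectSum.
Context {R : realType} {G : hilbertType R}.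
Implicit Types c d : R^o ⊕ G.

Lemma hsum_hdotE c d : '[c, d] = c.1 * d.1 + '[c.2, d.2].
Proof. by []. Qed.

Lemma le_norm_hsum1 c : `|c.1| <= `|c| :> R.
Proof.
rewrite -ler_sqr ?nnegrE// !sqr_norm_hdot hsum_hdotE.
by rewrite lerDl hdot_ge0.
Qed.

Lemma le_norm_hsum2 c : `|c.2| <= `|c| :> R.
Proof.
rewrite -ler_sqr ?nnegrE// !sqr_norm_hdot hsum_hdotE.
by rewrite lerDr -expr2 sqr_ge0.
Qed.

End DirectSum.

(** * Projection onto a closed convex set *)

Section Projection.
Context {R : realType} {H : hilbertType R}.
Implicit Types (C : set H) (x p c : H).

Definition convex_subset C :=
  forall c d (t : R), 0 < t < 1 -> C c -> C d -> C (t *: c + (1 - t) *: d).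

(** The parallelogram identity for x - c and x - d. The midpoint of c and d is
written as a convex combination, the form in which a convex set contains it. *)
Lemma parallelogram x c d : '[c - d, c - d] =
  2 * '[x - c, x - c] + 2 * '[x - d, x - d]
  - 4 * '[x - (2^-1 *: c + (1 - 2^-1) *: d), x - (2^-1 *: c + (1 - 2^-1) *: d)] :> R.
Proof.
rewrite !hdotE (hdotC c x) (hdotC d x) (hdotC d c).
by field.
Qed.

(** The points of C whose squared distance to x is within e of the infimum d
form, as e decreases, a Cauchy filter: their midpoints are in C, so the
parallelogram identity bounds the squared distance of two of them by 4 e. The
limit attains the infimum, and comparing it with the points p + t (c - p) for
small t gives the variational inequality. *)
Lemma projection_exists C x : closed C -> convex_subset C -> C !=set0 ->
  exists2 p, C p & forall c, C c -> '[x - p, c - p] <= 0 :> R.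
Proof.
move=> Ccl Ccv C0.
pose sqdist c : R := '[x - c, x - c].
pose D := [set sqdist c | c in C].
have D0 : has_inf D.
  split; first by case: C0 => c Cc; exists (sqdist c), c.
  by exists 0 => _ [c _ <-]; exact: hdot_ge0.
pose d := inf D.
have dle c : C c -> d <= sqdist c by move=> Cc; apply: ge_inf; [case: D0|exists c].
pose M e := [set c | C c /\ sqdist c < d + e].
have M0 e : 0 < e -> M e !=set0.
  move=> e0; have [_ [c Cc <-] ce] := inf_adherent e0 D0.
  by exists c.
pose F := filter_from [set e : R | 0 < e] M.
have FF : ProperFilter F.
  apply: filter_from_proper; last by move=> e; exact: M0.
  apply: filter_from_filter; first by exists 1 => /=.
  move=> a b a0 b0; exists (Num.min a b); first by rewrite /= lt_min a0.
  move=> c [Cc]; rewrite -ltrBlDl lt_min => /andP[ca cb].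
  by split; split => //; rewrite -ltrBlDl.
have diam e b c : M e b -> M e c -> `|b - c| ^+ 2 < 4 * e.
  move=> [Cb be] [Cc ce]; rewrite sqr_norm_hdot (parallelogram x).
  have /dle : C (2^-1 *: b + (1 - 2^-1) *: c).
    by apply: Ccv => //; rewrite invr_gt0 invf_lt1 ?ltr1n// ltr0n.
  rewrite /sqdist in be ce *; lra.
have /cauchy_cvg/cvg_ex[p Fp] : cauchy F.
  apply/cauchyP => e e0.
  have e2 : 0 < e ^+ 2 / 4 by rewrite divr_gt0 ?exprn_gt0.
  have [c Mc] := M0 _ e2; exists c; exists (e ^+ 2 / 4) => // b Mb.
  rewrite -ball_normE /= -ltr_sqr ?nnegrE ?(ltW e0)//.
  by have := diam _ _ _ Mc Mb; rewrite mulrC divfK.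
have Cp : C p.
  apply: (@closed_cvg _ _ F FF id C Ccl _ p Fp).
  by exists 1 => //= c [].
have pd : sqdist p <= d.
  apply/ler_addgt0Pr => e e0.
  suff : closed [set c | `|x - c| <= Num.sqrt (d + e)].
    move=> cl.
    have de : 0 <= d + e.
      by have [c [_ /ltW]] := M0 _ e0; apply: le_trans; exact: hdot_ge0.
    have : `|x - p| <= Num.sqrt (d + e).
      apply: (@closed_cvg _ _ F FF id _ cl _ p Fp); exists e => //= c [_ /ltW].
      by rewrite /sqdist -sqr_norm_hdot => /ler_wsqrtr; rewrite sqrtr_sqr normr_id.
    rewrite -ler_sqr ?nnegrE ?sqrtr_ge0// sqr_sqrtr//.
    by rewrite sqr_norm_hdot.
  apply: (@closed_comp _ _ (fun c : H => `|x - c|) [set t | t <= _]).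
    move=> c _; apply: cvg_norm.
    by apply: cvgB; [exact: cvg_cst|exact: cvg_id].
  exact: closed_le.
exists p => // c Cc.
have quad t : 0 < t < 1 -> 2 * '[x - p, c - p] <= t * '[c - p, c - p] :> R.
  move=> t01; have /dle/(le_trans pd) := Ccv _ _ _ t01 Cc Cp.
  rewrite /sqdist.
  have -> : x - (t *: c + (1 - t) *: p) = (x - p) - t *: (c - p).
    by rewrite scalerBl scale1r scalerBr !opprD !opprK -addrA; congr +%R; rewrite addrCA.
  move: (x - p) (c - p) => a b; rewrite !hdotE (hdotC b a).
  case/andP: t01 => t0 _ h; rewrite -(ler_pM2l t0); lra.
rewrite leNgt; apply/negP => pos.
set s := '[x - p, c - p] in pos quad.
set q := '[c - p, c - p] in quad.
have q0 : 0 <= q by exact: hdot_ge0.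
(* This t lies in ]0, 1[ and makes the quadratic term t q at most s, against the
   lower bound 2 s. *)
pose t := s / (s + q + 1).
have t0 : 0 < t by rewrite divr_gt0// ltr_wpDl// addr_ge0// ltW.
have /quad : 0 < t < 1 by rewrite t0 ltr_pdivrMr ?mul1r; lra.
suff : t * q <= s by lra.
by rewrite /t mulrAC ler_pdivrMr ?ler_pM2l//; lra.
Qed.

End Projection.

(** * Affine minorants and conjugates *)

Section AffineMinorants.
Context {R : realType} {G : hilbertType R}.
Implicit Types (phi : G -> \bar R) (u v w x : G).

(** The pair (m, u) encodes the affine function m + <., u>. *)
Definition affine_minorants phi : set (R^o ⊕ G) :=
  [set c | forall x, (c.1 + '[x, c.2])%:E <= phi x]%E.

Definition epigraph phi : set (R^o ⊕ G) := [set c | phi c.2 <= c.1%:E]%E.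

Lemma affine_minorants_conjugate phi m u :
  affine_minorants phi (m, u) <-> (conjugate phi u <= (- m)%:E)%E.
Proof.
split=> [mu | cu x].
  apply: ge_ereal_sup => _ [x _ <-]; have := mu x; case: (phi x) => //= [s|_].
    by rewrite !lee_fin; lra.
  by rewrite leNye.
have : ('[x, u]%:E - phi x <= (- m)%:E)%E.
  apply: le_trans cu; by apply: ereal_sup_ubound; exists x.
case: (phi x) => //= [s|]; first by rewrite !lee_fin; lra.
by rewrite leey.
Qed.

(** Each point x of the domain contributes one closed half-space, with normal
(1, x). *)
Lemma closed_affine_minorants phi :
  (forall x, -oo < phi x)%E -> closed (affine_minorants phi).
Proof.
move=> phiNy.
rewrite (_ : affine_minorants phi = \bigcap_(x in edom phi)
    [set c | '[((1, x) : R^o ⊕ G), c] <= fine (phi x)]); last first.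
  apply/seteqP; split=> [c cphi x /= xdom | c cdom x].
    rewrite hsum_hdotE mul1r -lee_fin fineK ?cphi//.
    by rewrite fin_real// phiNy.
  have := cdom x; have := phiNy x; rewrite /edom /= hsum_hdotE mul1r.
  case: (phi x) => [s| |//] _ /=; last by rewrite leey.
  by rewrite ltry lee_fin; apply.
by apply: closed_bigI => x _; exact: closed_halfspace.
Qed.

Lemma convex_affine_minorants phi : convex_subset (affine_minorants phi).
Proof.
move=> [a u] [b v] t /andP[t0 t1] au bv x; have := au x; have := bv x.
rewrite /= !hdotE.
case: (phi x) => [s| |//]; last by rewrite !leey.
rewrite !lee_fin => bs as'.
have : t * (a + '[x, u]) <= t * s by rewrite ler_pM2l.
have : (1 - t) * (b + '[x, v]) <= (1 - t) * s by rewrite ler_pM2l// subr_gt0.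
rewrite /GRing.scale /=; lra.
Qed.

Lemma convex_epigraph phi :
  (forall x, -oo < phi x)%E -> econvex phi -> convex_subset (epigraph phi).
Proof.
move=> phiNy cvx [a u] [b v] t t01; rewrite /epigraph /= => ua vb.
apply: (le_trans (cvx _ _ _ t01)); case/andP: t01 => t0 t1.
rewrite -[leRHS]/((t * a)%:E + ((1 - t) * b)%:E)%E !EFinM.
by apply: leeD; rewrite lee_pmul2l// lte_fin subr_gt0.
Qed.

Lemma closed_epigraph phi :
  lower_semicontinuous phi -> closed (epigraph phi).
Proof.
move=> lsc; rewrite -openC openE => -[s v] /= /negP; rewrite -ltNge /= => sv.
have [a sa av] : exists2 a : R, s < a & (a%:E < phi v)%E.
  case: (phi v) sv => [b||//].
    rewrite lte_fin => sb; exists ((s + b) / 2); rewrite ?lte_fin; lra.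
  by exists (s + 1); rewrite ?ltry// ltrDl.
have [V /nbhs_ballP[e /= e0 eV] Va] := lsc _ _ av.
apply/nbhs_ballP; exists (Num.min e (a - s)) => /=.
  by rewrite lt_min e0 subr_gt0.
move=> d; rewrite -ball_normE /= lt_min => /andP[de da].
apply/negP; rewrite -ltNge (@lt_trans _ _ a%:E)//.
  have := le_lt_trans (le_norm_hsum1 _) da.
  by rewrite lte_fin distrC /= => /(le_lt_trans (ler_norm _)); lra.
apply: Va; apply: eV; rewrite -ball_normE /=.
exact: le_lt_trans (le_norm_hsum2 ((s, v) - d)) de.
Qed.

(** The projection p of (r, u) onto the epigraph of phi, with its variational
inequality tested at the points (phi v, v) only. The bound r <= p.1 comes from
testing it at a point above p in the epigraph. *)
Lemma epigraph_projection phi r u : Gamma0 phi ->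
  exists p : R^o ⊕ G, [/\ (phi p.2 <= p.1%:E)%E, r <= p.1 &
    forall v s, phi v = s%:E ->
      (r - p.1) * (s - p.1) + '[u - p.2, v - p.2] <= 0].
Proof.
case=> phiNy [x0 x0dom] lsc cvx.
have phix0 : phi x0 = (fine (phi x0))%:E by rewrite fineK// fin_real// phiNy.
have [|||[b w] pe pp] := @projection_exists R _ (epigraph phi) (r, u).
- exact: closed_epigraph.
- exact: convex_epigraph.
- by exists (fine (phi x0), x0); rewrite /epigraph /= -phix0.
exists (b, w); split=> //=.
  have /pp : epigraph phi (b + 1, w).
    by rewrite /epigraph /= (le_trans pe)// lee_fin lerDl.
  by rewrite hsum_hdotE /= subrr hdot0r addr0 addrAC subrr add0r mulr1 subr_le0.
by move=> v s vs; have /pp : epigraph phi (s, v) by rewrite /epigraph /= vs.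
Qed.

(** When b > r the hyperplane through (b, w) orthogonal to (r - b, u - w) is not
vertical: dividing by b - r turns the variational inequality into an affine
minorant, whose value at u is b plus a nonnegative term. *)
Lemma affine_minorant_of_projection phi r u b w :
  (forall x, -oo < phi x)%E -> r < b ->
  (forall v s, phi v = s%:E -> (r - b) * (s - b) + '[u - w, v - w] <= 0) ->
  exists2 c, affine_minorants phi c & r < c.1 + '[u, c.2].
Proof.
move=> phiNy rb pp; have k0 : 0 < (b - r)^-1 by rewrite invr_gt0 subr_gt0.
exists (b - '[w, (b - r)^-1 *: (u - w)], (b - r)^-1 *: (u - w)) => /=.
  move=> v /=; have := pp v; have := phiNy v.
  case: (phi v) => [s| |//] _; last by rewrite leey.
  move=> /(_ s erefl); rewrite -(pmulr_rle0 _ k0) mulrDr mulrA.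
  rewrite -[r - b]opprB mulrN mulVf ?gt_eqF ?subr_gt0// lee_fin.
  by rewrite !hdotE (hdotC v u) (hdotC v w) (hdotC u w); lra.
apply: (lt_le_trans rb); rewrite -addrA lerDl addrC -hdotNl -hdotDl hdotZr.
by rewrite mulr_ge0 ?hdot_ge0 ?ltW.
Qed.

(** At a point u of the domain the separating hyperplane cannot be vertical:
otherwise the variational inequality at v = u gives u = w, so (r, u) would be in
the epigraph. *)
Lemma lt_affine_minorant_dom phi r u : Gamma0 phi ->
  (r%:E < phi u)%E -> edom phi u ->
  exists2 c, affine_minorants phi c & r < c.1 + '[u, c.2].
Proof.
move=> phiG ru udom; have [phiNy _ _ _] := phiG.
have [[b w] /= [wb rb pp]] := epigraph_projection r u phiG.
have [rltb|ble] := ltP r b; first exact: affine_minorant_of_projection pp.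
have phiu : phi u = (fine (phi u))%:E by rewrite fineK// fin_real// phiNy.
have br : b = r by apply/eqP; rewrite eq_le ble.
have := pp _ _ phiu; rewrite br subrr mul0r add0r => h.
suff uw : u = w by move: ru; rewrite uw ltNge -br wb.
by apply/eqP; rewrite -subr_eq0 -hdot_eq0 eq_le h hdot_ge0.
Qed.

Lemma affine_minorants_neq0 phi : Gamma0 phi -> affine_minorants phi !=set0.
Proof.
move=> phiG; have [phiNy [x xdom] _ _] := phiG.
have phix : phi x = (fine (phi x))%:E by rewrite fineK// fin_real// phiNy.
have [|c cphi _] := @lt_affine_minorant_dom phi (fine (phi x) - 1) x phiG _ xdom.
  by rewrite phix lte_fin; lra.
by exists c.
Qed.

(** The Fenchel-Moreau theorem: phi is the supremum of its affine minorants. If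
the separating hyperplane is vertical, its normal n satisfies <n, v - w> <= 0 on
the domain and <n, u - w> > 0, so a large multiple of <n, . - w> can be added to
any affine minorant to raise its value at u above r. *)
Lemma lt_affine_minorant phi r u : Gamma0 phi -> (r%:E < phi u)%E ->
  exists2 c, affine_minorants phi c & r < c.1 + '[u, c.2].
Proof.
move=> phiG ru; have [phiNy _ _ _] := phiG.
have [[b w] /= [wb rb pp]] := epigraph_projection r u phiG.
have [rltb|ble] := ltP r b; first exact: affine_minorant_of_projection pp.
have br : b = r by apply/eqP; rewrite eq_le ble.
have uw : u - w != 0.
  by apply: contraTneq ru => /eqP; rewrite subr_eq0 => /eqP ->; rewrite -leNgt -br.
have [[m q] mq] := affine_minorants_neq0 phiG.
set n := u - w in uw pp.
have un : '[u, n] = '[n, n] + '[w, n] by rewrite -hdotDl subrK.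
clearbody n.
have n0 := hdot_gt0 uw.
(* With this t the corrected minorant exceeds r at u by at least 1. *)
pose t := (`|r - (m + '[u, q])| + 1) / '[n, n].
have t0 : 0 <= t by rewrite divr_ge0 ?hdot_ge0// addr_ge0.
exists (m - t * '[w, n], q + t *: n) => /=.
  move=> v /=; have := mq v; have := pp v; have := phiNy v.
  case: (phi v) => [s| |//] _; last by rewrite !leey.
  move=> /(_ s erefl); rewrite br subrr mul0r add0r => h; rewrite !lee_fin /=.
  have : t * '[n, v - w] <= 0 by rewrite mulr_ge0_le0.
  by rewrite !hdotE (hdotC n v) (hdotC n w); lra.
have tn : t * '[n, n] = `|r - (m + '[u, q])| + 1 by rewrite divfK// gt_eqF.
have := ler_norm (r - (m + '[u, q])).
rewrite hdotDr hdotZr un mulrDr tn; lra.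
Qed.

Lemma conjugate_gtNy phi u : Gamma0 phi -> (-oo < conjugate phi u)%E.
Proof.
case=> phiNy [x xdom] _ _.
apply: (@lt_le_trans _ _ ('[x, u]%:E - phi x)%E); last first.
  by apply: ereal_sup_ubound; exists x.
have := phiNy x; move: xdom; rewrite /edom /=.
by case: (phi x) => // s _ _; rewrite ltNyr.
Qed.

(** The epigraph of the conjugate is, up to the sign of the first component, the
set of affine minorants of phi. *)
Lemma convex_conjugate phi : Gamma0 phi -> econvex (conjugate phi).
Proof.
move=> phiG u v t /[dup] t01 /andP[t0 t1].
have s0 : 0 < 1 - t by rewrite subr_gt0.
have := conjugate_gtNy u phiG; have := conjugate_gtNy v phiG.
case fu : (conjugate phi u) => [a| |//] vNy _; last first.
  rewrite gt0_muley ?lte_fin// addye ?leey//.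
  case fv : (conjugate phi v) vNy => [b| |//] _ //.
  by rewrite gt0_muley ?lte_fin.
case fv : (conjugate phi v) vNy => [b| |//] _; last first.
  by rewrite gt0_muley ?lte_fin// addey ?leey.
have /affine_minorants_conjugate au : (conjugate phi u <= (- - a)%:E)%E.
  by rewrite opprK fu.
have /affine_minorants_conjugate bv : (conjugate phi v <= (- - b)%:E)%E.
  by rewrite opprK fv.
have := convex_affine_minorants t01 au bv.
move/affine_minorants_conjugate; rewrite /= /GRing.scale /=.
by rewrite mulrN mulrN opprD !opprK -!EFinM -EFinD.
Qed.

Lemma subdiff_dom (f : G -> \bar R) p : edom f !=set0 ->
  subdiff f p !=set0 -> edom f p.
Proof.
move=> [w wdom] [u /(_ w wdom)] h; rewrite /edom /= ltNge leye_eq.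
by apply/negP => /eqP fp; move: h wdom; rewrite fp addey// leye_eq /edom /= => /eqP ->.
Qed.

(** If phi u were larger than <u, p> - f p, where f is the conjugate, some affine
minorant would exceed that value at u; its slope q would violate the
subgradient inequality of f between p and q. *)
Lemma subdiff_conjugate phi a p u : Gamma0 phi -> conjugate phi p = a%:E ->
  subdiff (conjugate phi) p u -> phi u = ('[u, p] - a)%:E.
Proof.
move=> phiG fp up; apply/eqP; rewrite eq_le; apply/andP; split.
  rewrite leNgt; apply/negP => /(lt_affine_minorant phiG)[[m q]].
  move=> /affine_minorants_conjugate mq /= ltm.
  have /up : edom (conjugate phi) q by rewrite /edom /= (le_lt_trans mq) ?ltry.
  rewrite fp => /le_trans/(_ mq); rewrite -EFinD lee_fin !hdotE.
  by move: ltm; rewrite (hdotC u p) (hdotC u q); lra.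
have /affine_minorants_conjugate /(_ u) : (conjugate phi p <= (- - a)%:E)%E.
  by rewrite opprK fp.
by rewrite /= addrC.
Qed.

(** By convexity the difference quotient of f from q to w at t in ]0, 1[ is at
most f w - f q, and its limit at 0 from the right shows that g is a subgradient.
Conversely a subgradient u bounds every quotient with t > 0 from below
by <v, u>, so <v, u> <= <v, g> for all v, in particular for v = u - g. *)
Lemma subdiff_gradient (f : G -> \bar R) q g : econvex f ->
  (forall x, -oo < f x)%E -> gradient_at f q g -> subdiff f q = [set g].
Proof.
move=> cvx fNy [fq fg].
have fgr v : (fun t : R => t^-1%:E * (f (q + t *: v)%R - f q))%E @ 0^'+ --> '[v, g]%:E.
  exact: cvg_dnbhs_at_right (fg v).
have sub : subdiff f q g.
  move=> w wdom; rewrite /edom /= in wdom.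
  have fw : f w \is a fin_num by rewrite fin_real// fNy.
  rewrite -leeBrDr//.
  apply: cvge_le (fgr (w - q)).
  near=> t.
  have t01 : 0 < t < 1 by apply/andP; split; near: t; [exact: nbhs_right_gt|exact: nbhs_right_lt].
  have := cvx w q _ t01.
  have -> : t *: w + (1 - t) *: q = q + t *: (w - q).
    by rewrite scalerBl scale1r scalerBr addrCA; congr +%R; rewrite addrC.
  case/andP: t01 => t0 t1; have := fNy (q + t *: (w - q)).
  rewrite -(fineK fq) -(fineK fw) -!EFinM -EFinD.
  case: (f (q + _)) => [s| |//] _; last by rewrite leye_eq.
  rewrite !lee_fin ler_pdivrMl// => h; lra.
apply/seteqP; split=> [u usub /= | _ -> //].
have le v : '[v, u] <= '[v, g] :> R.
  rewrite -lee_fin; apply: cvge_ge (fgr v).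
  near=> t; have t0 : 0 < t by [].
  have := fNy (q + t *: v); have := usub (q + t *: v); rewrite /edom /=.
  rewrite -(fineK fq); case: (f (q + _)) => [s| |//] h _; last first.
    by rewrite addye// gt0_muley ?lte_fin ?invr_gt0// leey.
  have := h (ltry _); rewrite !lee_fin ler_pdivlMl// addrAC subrr add0r hdotZl.
  by move=> ?; lra.
apply/eqP; rewrite -subr_eq0 -hdot_eq0 eq_le hdot_ge0 andbT.
by have := le (u - g); rewrite !hdotE; lra.
Unshelve. all: by end_near. Qed.

End AffineMinorants.

(** * Recession functions and perspectives *)

Section Perspective.
Context {R : realType} {G : hilbertType R}.
Implicit Types (phi : G -> \bar R) (u v w x y z : G).

(** The point z + a y is a convex combination of z and z + b y, with weight a / b
on the latter. *)
Lemma difference_quotient_nondecreasing phi z y (a b : R) :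
  (forall x, -oo < phi x)%E -> econvex phi -> phi z \is a fin_num ->
  0 < a -> a <= b ->
  (a^-1%:E * (phi (z + a *: y)%R - phi z) <=
   b^-1%:E * (phi (z + b *: y)%R - phi z))%E.
Proof.
move=> phiNy cvx phiz a0; rewrite le_eqVlt => /predU1P[->//|ab].
have b0 := lt_trans a0 ab.
have t01 : 0 < a / b < 1 by rewrite divr_gt0//= ltr_pdivrMr// mul1r.
have := cvx (z + b *: y) z _ t01.
have -> : (a / b) *: (z + b *: y) + (1 - a / b) *: z = z + a *: y.
  by rewrite scalerDr scalerBl scale1r scalerA divfK ?gt_eqF// addrC -addrA addKr.
have := phiNy (z + a *: y); have := phiNy (z + b *: y).
rewrite -(fineK phiz); case: (phi (z + b *: y)) => [s| |//] _.
  case: (phi (z + a *: y)) => [r| |//] _; last by rewrite leye_eq.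
  rewrite !lee_fin => h.
  rewrite ler_pdivrMl// mulrA; lra.
by move=> _ _; rewrite addye// gt0_muley ?leey// lte_fin invr_gt0.
Qed.

Lemma cvg_invrMr_pinfty (r : R) :
  (a^-1 * r)%:E @[a --> +oo] --> (0 : \bar R)%E.
Proof.
apply: cvg_EFin; first by near=> a.
rewrite -(mul0r r); apply: cvgMl.
apply/gtr0_cvgV0; last exact: cvg_id.
exact: nbhs_pinfty_gt.
Unshelve. all: by end_near. Qed.

(** Writing phi(z + a y) / a as (phi(z + a y) - phi z) / a + phi z / a gives a
nondecreasing function of a plus one that tends to 0. *)
Lemma recession_is_cvg phi y : Gamma0 phi ->
  let z := xget 0 (edom phi) in
  cvg ((fun a : R => a^-1%:E * phi (z + a *: y)%R)%E @ +oo%R).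
Proof.
move=> phiG z; have [phiNy phidom _ cvx] := phiG.
have zdom : edom phi z by apply: xgetPex.
have phiz : phi z \is a fin_num by rewrite fin_real// phiNy.
pose h a := (a^-1%:E * (phi (z + a *: y)%R - phi z))%E.
(* The quotient is monotone for a > 0 only, hence the truncation at 1. *)
have h_cvg : h (Num.max a 1) @[a --> +oo] -->
    ereal_sup (range (h \o (Num.max ^~ 1))).
  apply: nondecreasing_cvge => a b ab; apply: difference_quotient_nondecreasing => //.
    by rewrite lt_max ltr01 orbT.
  by rewrite ge_max !le_max ab lexx/= orbT.
have inv_cvg := cvg_invrMr_pinfty (fine (phi z)).
apply/cvg_ex; eexists; apply: cvg_trans (cvgeD _ h_cvg inv_cvg).
  apply: near_eq_cvg; near=> a.
  have a0 : 0 < a by near: a; exact: nbhs_pinfty_gt.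
  have a1 : 1 <= a by near: a; exact: nbhs_pinfty_ge.
  rewrite max_l//.
  rewrite /h -{1 2}(fineK phiz); have := phiNy (z + a *: y).
  case: (phi (z + _)) => [s| |//] _.
    by rewrite -!EFinM -EFinD mulrBr subrK.
  by rewrite addye// gt0_muley ?lte_fin ?invr_gt0.
by rewrite fin_num_adde_defl.
Unshelve. all: by end_near. Qed.

(** Along z + a y a minorant m + <., u> has slope <y, u>; its value at z is
negligible after division by a. *)
Lemma affine_minorant_recession phi c y : Gamma0 phi ->
  affine_minorants phi c -> ('[y, c.2]%:E <= recession phi y)%E.
Proof.
move=> phiG cphi; set z := xget 0 (edom phi).
apply/lee_addgt0Pr => e e0; rewrite -leeBlDr//.
apply: lime_ge; first exact: recession_is_cvg.
near=> a.
have a0 : 0 < a by near: a; exact: nbhs_pinfty_gt.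
have ae : `|c.1 + '[z, c.2]| / e <= a.
  by near: a; apply: nbhs_pinfty_ge; rewrite num_real.
have := cphi (z + a *: y); rewrite -/z.
case: (phi (z + _)) => [s| |//]; last first.
  by rewrite gt0_muley ?lte_fin ?invr_gt0// !leey.
rewrite lee_fin -EFinB lee_fin ler_pdivlMl// !hdotE.
have : - `|c.1 + '[z, c.2]| <= c.1 + '[z, c.2] by rewrite lerNl -normrN ler_norm.
by move: ae; rewrite ler_pdivrMr//; lra.
Unshelve. all: by end_near. Qed.

Lemma recession0 phi : Gamma0 phi -> recession phi 0 = 0%E.
Proof.
move=> phiG; rewrite /recession; set z := xget 0 (edom phi).
have [phiNy phidom _ _] := phiG.
have zdom : edom phi z by apply: xgetPex.
have phiz : phi z \is a fin_num by rewrite fin_real// phiNy.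
apply: cvg_lim => //.
rewrite (_ : (fun a : R => _) = fun a : R => (a^-1 * fine (phi z))%:E); last first.
  by apply/funext => a; rewrite scaler0 addr0 EFinM fineK.
exact: cvg_invrMr_pinfty.
Qed.

Lemma affine_minorant_perspective phi c (x : R^o ⊕ G) : Gamma0 phi ->
  affine_minorants phi c -> ('[x, c]%:E <= perspective phi x)%E.
Proof.
move=> phiG cphi; rewrite /perspective hsum_hdotE.
have [x0|x0] := ltP 0 x.1.
  have := cphi (x.1^-1 *: x.2); case: (phi _) => [s| |//]; last first.
    by rewrite gt0_muley ?lte_fin// !leey.
  rewrite hdotZl !lee_fin -(ler_pM2l x0) mulrDr mulrA divff ?gt_eqF// mul1r.
  by rewrite mulrC.
have [->|x1] := eqVneq x.1 0; last by rewrite leey.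
by rewrite mul0r add0r; exact: affine_minorant_recession.
Qed.

Lemma perspective0 phi : Gamma0 phi -> perspective phi (0, 0) = 0%E.
Proof. by move=> phiG; rewrite /perspective /= ltxx eqxx recession0. Qed.

End Perspective.

(** * Proximity operator of a perspective *)

(** Completing the square, <x, z - p> + |z - x|^2 / 2 equals its value at x = p
plus |x - p|^2 / 2. *)
Lemma prox_support (R : realType) (H : hilbertType R) (F : H -> \bar R)
    (z p : H) :
  F p = '[p, z - p]%:E -> (forall x, '[x, z - p]%:E <= F x)%E ->
  prox F z = [set p].
Proof.
move=> Fp Fge.
have growth x : (('[p, z - p] + 2^-1 * '[z - p, z - p]
    + 2^-1 * '[x - p, x - p])%:E <= F x + (2^-1 * `|z - x| ^+ 2)%:E)%E.
  apply: le_trans (leeD (Fge x) (lexx _)).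
  rewrite -EFinD lee_fin sqr_norm_hdot !hdotE.
  by rewrite (hdotC x p) (hdotC x z) (hdotC z p); lra.
have Fpz : (F p + (2^-1 * `|z - p| ^+ 2)%:E)%E =
    ('[p, z - p] + 2^-1 * '[z - p, z - p])%:E.
  by rewrite Fp sqr_norm_hdot -EFinD.
apply/seteqP; split=> [w /(_ p) wmin /= | _ -> x /=].
  have := le_trans (growth w) wmin; rewrite Fpz lee_fin gerDl pmulr_rle0 ?invr_gt0//.
  by move=> h; apply/eqP; rewrite -subr_eq0 -hdot_eq0 eq_le h hdot_ge0.
by rewrite Fpz (le_trans _ (growth x))// lee_fin lerDl mulr_ge0 ?hdot_ge0.
Qed.

Section ProxPerspective.
Context {R : realType} {G : hilbertType R}.
Context (phi : G -> \bar R) (gamma eta : R) (y : G).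
Context (phiG : Gamma0 phi) (gamma0 : 0 < gamma).

Local Notation prox_persp :=
  (prox (fun x : R^o ⊕ G => (gamma%:E * perspective phi x)%E) (eta, y)).

Lemma prox_perspective0 :
  (eta%:E + gamma%:E * conjugate phi (gamma^-1 *: y)%R <= 0)%E ->
  prox_persp = [set (0, 0)].
Proof.
move=> le0.
have cphi : affine_minorants phi (gamma^-1 * eta, gamma^-1 *: y).
  apply/affine_minorants_conjugate; move: le0.
  have := conjugate_gtNy (gamma^-1 *: y) phiG.
  case: (conjugate _ _) => [a| |//] _; last first.
    by rewrite gt0_muley ?lte_fin// addey.
  rewrite !lee_fin => h; rewrite -mulrN -(ler_pM2l gamma0) mulrA divff ?gt_eqF//.
  by rewrite mul1r; lra.
have zp : ((eta, y) : R^o ⊕ G) - (0, 0) =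
    gamma *: ((gamma^-1 * eta, gamma^-1 *: y) : R^o ⊕ G).
  congr (_, _) => /=; rewrite subr0.
    by rewrite /GRing.scale /= mulrA divff ?mul1r ?gt_eqF.
  by rewrite scalerA divff ?scale1r ?gt_eqF.
apply: (@prox_support R (R^o ⊕ G) _ (eta, y) (0, 0)).
  by rewrite perspective0// mule0 hdot0l.
move=> x; rewrite zp hdotZr EFinM lee_pmul2l ?lte_fin//.
exact: affine_minorant_perspective.
Qed.

Lemma conjugate_fin_subdiff q u :
  subdiff (conjugate phi) q u -> conjugate phi q \is a fin_num.
Proof.
move=> qu; rewrite fin_real// conjugate_gtNy//=.
apply: subdiff_dom; last by exists u.
have [[m v] /affine_minorants_conjugate mv] := affine_minorants_neq0 phiG.
by exists v; rewrite /edom /= (le_lt_trans mv)// ltry.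
Qed.

Lemma prox_perspective_inclusion q :
  (0 < eta%:E + gamma%:E * conjugate phi q)%E ->
  prox_inclusion (conjugate phi) gamma eta y q ->
  prox_persp = [set (fine (eta%:E + gamma%:E * conjugate phi q)%E,
                     y - gamma *: q)].
Proof.
move=> tau0 [u qu yE].
have [a fq] : exists a, conjugate phi q = a%:E.
  by exists (fine (conjugate phi q)); rewrite fineK ?(conjugate_fin_subdiff qu).
rewrite fq /= in tau0 yE *; rewrite lte_fin in tau0.
have phiu := subdiff_conjugate phiG fq qu.
have yq : y - gamma *: q = (eta + gamma * a) *: u by rewrite -yE addrAC subrr add0r.
set tau := eta + gamma * a in tau0 yE yq *.
have cphi : affine_minorants phi (- a, q).
  by apply/affine_minorants_conjugate; rewrite opprK fq.
have zp : ((eta, y) : R^o ⊕ G) - (tau, y - gamma *: q) = gamma *: ((- a, q) : R^o ⊕ G).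
  congr (_, _) => /=; last by rewrite opprB addrC subrK.
  by rewrite /GRing.scale /= /tau opprD addNKr mulrN.
apply: (@prox_support R (R^o ⊕ G) _ (eta, y) (tau, y - gamma *: q)).
  rewrite zp hdotZr hsum_hdotE /= yq /perspective /= tau0.
  rewrite scalerA mulVf ?gt_eqF// scale1r phiu -!EFinM hdotZl; congr (_ %:E).
  by ring.
move=> x; rewrite zp hdotZr EFinM lee_pmul2l ?lte_fin//.
exact: affine_minorant_perspective.
Qed.

(** The point p is the second component of the projection of (eta, y) / gamma
onto the set of affine minorants. The residual (e - m, v - p) is an outward
normal there; divided by e - m > 0, its second component is the subgradient. *)
Lemma prox_inclusion_exists : open (edom (conjugate phi)) ->
  (0 < eta%:E + gamma%:E * conjugate phi (gamma^-1 *: y)%R)%E ->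
  exists2 p, (0 < eta%:E + gamma%:E * conjugate phi p)%E &
    prox_inclusion (conjugate phi) gamma eta y p.
Proof.
set f := conjugate phi; set v := gamma^-1 *: y; move=> domo pos.
pose e := gamma^-1 * eta.
have etaE : eta = gamma * e by rewrite mulrA divff ?mul1r ?gt_eqF.
have yE : y = gamma *: v by rewrite scalerA divff ?scale1r ?gt_eqF.
have [|||[m p] mp vi] := @projection_exists R _ (affine_minorants phi) (e, v).
- by apply: closed_affine_minorants; case: phiG.
- exact: convex_affine_minorants.
- exact: affine_minorants_neq0.
have {}vi m' q : (f q <= (- m')%:E)%E ->
    (e - m) * (m' - m) + '[v - p, q - p] <= 0.
  by move=> /affine_minorants_conjugate/vi.
have {mp} fp : (f p <= (- m)%:E)%E by apply/affine_minorants_conjugate.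
have [a fpa] : exists a, f p = a%:E.
  exists (fine (f p)); rewrite fineK// fin_real// conjugate_gtNy//=.
  by rewrite (le_lt_trans fp) ?ltry.
have am : a <= - m by rewrite -lee_fin -fpa.
have me : m <= e.
  have /vi : (f p <= (- (m - 1))%:E)%E by rewrite fpa lee_fin; lra.
  by rewrite subrr hdot0r; lra.
have fv : (f v <= (- e)%:E)%E -> False.
  move=> fve; move: pos; rewrite ltNge => /negP; apply.
  apply: (@le_trans _ _ (eta%:E + gamma%:E * (- e)%:E)%E).
    by rewrite leeD2l// lee_pmul2l// lte_fin.
  by rewrite -EFinM -EFinD lee_fin etaE; lra.
(* If e = m, then v - p is normal to the domain of f at its interior point p. *)
have lt_me : m < e.
  rewrite lt_neqAle me andbT; apply/negP => /eqP em.
  have ray q : edom f q -> '[v - p, q - p] <= 0.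
    move=> qdom; have fq : f q = (fine (f q))%:E.
      by rewrite fineK// fin_real// conjugate_gtNy.
    have /vi : (f q <= (- - fine (f q))%:E)%E by rewrite opprK -fq.
    by rewrite -em subrr mul0r add0r.
  have pdom : edom f p by rewrite /edom /= fpa ltry.
  have cont : p + t *: (v - p) @[t --> (0 : R)^'+] --> p + 0 *: (v - p).
    apply: cvg_at_right_filter; apply: cvgD; first exact: cvg_cst.
    by apply: cvgZr_tmp; exact: cvg_id.
  rewrite scale0r addr0 in cont.
  have cont_dom := cont _ (open_nbhs_nbhs (conj domo pdom)).
  have [|t [t0 /ray]] := @filter_ex _ (0 : R)^'+ _
      (fun t => 0 < t /\ edom f (p + t *: (v - p))).
    near=> t; split; first by [].
    by near: t; exact: cont_dom.
  rewrite addrAC subrr add0r hdotZr pmulr_rle0// => h.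
  have vp : v = p.
    by apply/eqP; rewrite -subr_eq0 -hdot_eq0 eq_le h hdot_ge0.
  by apply: fv; rewrite vp -em.
have ma : m = - a.
  apply/eqP; rewrite eq_le; apply/andP; split; first by lra.
  have /vi : (f p <= (- - a)%:E)%E by rewrite opprK fpa.
  by rewrite subrr hdot0r addr0 pmulr_rle0 ?subr_gt0//; lra.
have ea : 0 < e + a by lra.
have tau : eta + gamma * a = gamma * (e + a) by rewrite etaE; lra.
exists p; first by rewrite -/f fpa -EFinM -EFinD lte_fin tau mulr_gt0.
exists ((e + a)^-1 *: (v - p)); last first.
  rewrite -/f fpa -EFinM -EFinD /= tau scalerA -mulrA divff ?gt_eqF// mulr1.
  by rewrite -scalerDr addrC subrK.
move=> q qdom; rewrite -/f.
have fq : f q = (fine (f q))%:E by rewrite fineK// fin_real// conjugate_gtNy.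
have /vi : (f q <= (- - fine (f q))%:E)%E by rewrite opprK -fq.
rewrite fpa fq -EFinD lee_fin ma opprK => h.
rewrite hdotZr hdotC -lerBrDr ler_pdivrMl//; lra.
Unshelve. all: by end_near. Qed.

End ProxPerspective.

(* The solution set of the inclusion is cut down to the points q such that
   eta + gamma phi^*(q) >= 0, which is implicit in the original: for
   G = R, phi(x) = x^2 / 20 (that is, phi^*(u) = 5 u^2), gamma = 1, eta = -1 and
   y = 0.45, the inclusion has two more solutions, with a negative
   coefficient. *)
Theorem theorem3p1 (R : realType) (G : hilbertType R) (phi : G -> \bar R)
    (gamma eta : R) (y : G) :
  Gamma0 phi -> 0 < gamma ->
  ((eta%:E + gamma%:E * conjugate phi (gamma^-1 *: y)%R <= 0)%E ->
   prox (fun x : R^o ⊕ G => (gamma%:E * perspective phi x)%E) (eta, y)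
     = [set (0, 0)])
  /\
  (open (edom (conjugate phi)) ->
   (0 < eta%:E + gamma%:E * conjugate phi (gamma^-1 *: y)%R)%E ->
   exists p : G,
     [/\ (0 < eta%:E + gamma%:E * conjugate phi p)%E,
         prox_inclusion (conjugate phi) gamma eta y p,
         forall q : G, (0 <= eta%:E + gamma%:E * conjugate phi q)%E ->
           prox_inclusion (conjugate phi) gamma eta y q -> q = p,
         prox (fun x : R^o ⊕ G => (gamma%:E * perspective phi x)%E) (eta, y)
           = [set (fine (eta%:E + gamma%:E * conjugate phi p),
                   y - gamma *: p)]
       & forall q g : G, (0 <= eta%:E + gamma%:E * conjugate phi q)%E ->
           gradient_at (conjugate phi) q g ->
           (q = p <->
            y = gamma *: q
                + fine (eta%:E + gamma%:E * conjugate phi q) *: g)]).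
Proof.
move=> phiG gamma0; split; first exact: prox_perspective0.
move=> domo pos.
have [p p0 py] := prox_inclusion_exists phiG gamma0 domo pos.
have proxp := prox_perspective_inclusion phiG gamma0 p0 py.
have uniq q : (0 <= eta%:E + gamma%:E * conjugate phi q)%E ->
    prox_inclusion (conjugate phi) gamma eta y q -> q = p.
  (* A vanishing coefficient forces q = y / gamma, where it is positive. *)
  rewrite le_eqVlt => /predU1P[q0 [u _ yE]|q0 qy].
    move: pos; rewrite -yE -q0 scale0r addr0 scalerA mulVf ?gt_eqF// scale1r.
    by rewrite -q0 ltxx.
  have : (prox (fun x : R^o ⊕ G => (gamma%:E * perspective phi x)%E) (eta, y))
      (fine (eta%:E + gamma%:E * conjugate phi p)%E, y - gamma *: p).
    by rewrite proxp.
  rewrite (prox_perspective_inclusion phiG gamma0 q0 qy) => -[_ /addrI/oppr_inj].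
  by move=> /(scalerI _) ->//; rewrite gt_eqF.
exists p; split=> // q g q0 qg.
have sub := subdiff_gradient (convex_conjugate phiG)
  (fun u => conjugate_gtNy u phiG) qg.
split=> [qp|yE].
  by move: py; rewrite -qp => -[u]; rewrite sub => ->.
by apply: uniq => //; exists g; rewrite ?sub.
Qed.
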